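(* Let $X$ be a digraph. All eigenvalues of $H(X)$ lie in the open interval $(-\sqrt{3},\sqrt{3})$ if and only if every weakly connected component $Y$ of $X$ satisfies one of the following: $\Gamma(Y)$ is isomorphic to a path with at most $3$ edges (including a single vertex); or $\Gamma(Y)$ is isomorphic to the $4$-cycle $C_4$ and $Y$ is isomorphic either to $\widetilde{C}_4$ or to a strongly connected digraph with underlying graph $C_4$ having exactly two digons.
   Context: A digraph $X$ has a finite vertex set and an arc set of ordered pairs of distinct vertices; $\{x,y\}$ is a digon if both $xy,yx$ are arcs. The underlying graph $\Gamma(X)$ is the simple graph with an edge $\{x,y\}$ whenever $xy$ or $yx$ is an arc; weakly connected components of $X$ are the sub-digraphs induced on the components of $\Gamma(X)$. The Hermitian adjacency matrix $H(X)$ has $(u,v)$-entry $1$ if $uv$ and $vu$ are arcs, $i$ if only $uv$ is an arc, $-i$ if only $vu$ is an arc, and $0$ otherwise. $\widetilde{C}_4$ is the oriented graph on vertices $v_0,v_1,v_2,v_3$ with arcs $v_0v_1, v_1v_2, v_2v_3, v_0v_3$ (the directed $4$-cycle with one arc reversed). *)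

(* Defs.v *)
From HB Require Import structures.
From mathcomp Require Import all_boot all_order all_algebra all_field.
Set Implicit Arguments. Unset Strict Implicit. Unset Printing Implicit Defensive.
Import Order.TTheory GRing.Theory Num.Theory.
Local Open Scope ring_scope.

(* A digraph on the vertex set 'I_n is an irreflexive relation [arc]. *)

Definition herm_adj (n : nat) (arc : rel 'I_n) : 'M[algC]_n :=
  \matrix_(u, v)
    (if arc u v && arc v u then 1
     else if arc u v then 'i
     else if arc v u then - 'i
     else 0).

Definition underlying (n : nat) (arc : rel 'I_n) : rel 'I_n :=
  [rel x y | arc x y || arc y x].

Definition weak_component (n : nat) (arc : rel 'I_n) (C : {set 'I_n}) : Prop :=
  exists x, C = [set y | connect (underlying arc) x y].

Definition iso_on (n : nat) (r : rel 'I_n) (C : {set 'I_n})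
    (m : nat) (G : rel 'I_m) : Prop :=
  exists f : 'I_m -> 'I_n,
    injective f /\ f @: [set: 'I_m] = C /\ (forall i j, r (f i) (f j) = G i j).

Definition path_graph (k : nat) : rel 'I_k.+1 :=
  fun i j : 'I_k.+1 => ((i.+1 == j :> nat) || (j.+1 == i :> nat))%N.

Definition cycle4 : rel 'I_4 :=
  fun i j : 'I_4 => ((i.+1 %% 4 == j :> nat) || (j.+1 %% 4 == i :> nat))%N.

Definition ctilde4 : rel 'I_4 :=
  fun i j : 'I_4 => (((i : nat), (j : nat)) \in [:: (0, 1); (1, 2); (2, 3); (0, 3)])%N.

Definition strongly_connected_on (n : nat) (arc : rel 'I_n) (C : {set 'I_n}) : Prop :=
  forall x y, x \in C -> y \in C ->
    connect [rel u v | [&& arc u v, u \in C & v \in C]] x y.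

Definition num_digons (n : nat) (arc : rel 'I_n) (C : {set 'I_n}) : nat :=
  #|[set p : 'I_n * 'I_n |
      [&& (p.1 < p.2)%N, arc p.1 p.2, arc p.2 p.1, p.1 \in C & p.2 \in C]]|.

Definition good_component (n : nat) (arc : rel 'I_n) (C : {set 'I_n}) : Prop :=
  (exists k, (k <= 3)%N /\ iso_on (underlying arc) C (@path_graph k))
  \/ (iso_on (underlying arc) C cycle4 /\
      (iso_on arc C ctilde4 \/
       (strongly_connected_on arc C /\ num_digons arc C = 2%N))).

(* Main.v *)
(* Forward direction: by the spectral theorem the hypothesis says |x H|^2 < 3 |x|^2 for
   all x <> 0. Taking x = e_u gives degrees at most 2; taking x = e_u + c e_v with a
   suitable unit c shows that two vertices u, v of degree 2 with a common neighbour have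
   both neighbours in common and that the two walks of length 2 from u to v have opposite
   weights. The components are then paths with at most 4 vertices and 4-cycles of weight
   -1, and the latter are found by inspecting the orientations of a 4-cycle.
   Backward direction: on a component, an eigenvector for a with |a|^2 >= 3 vanishes; on a
   path because |v| would have to grow too fast, on a 4-cycle of weight -1 because
   a^2 is 2 or a is 0. *)
Require Import Defs.
From HB Require Import structures.
From mathcomp Require Import all_boot all_order all_algebra all_field.
From mathcomp Require Import ring.
Import Order.TTheory GRing.Theory Num.Theory.
Local Open Scope ring_scope.
Local Open Scope sesquilinear_scope.
Set Implicit Arguments. Unset Strict Implicit. Unset Printing Implicit Defensive.

(** * Squared norms of row vectors and the spectral theorem for normal matrices *)

Definition sqnorm {C : numClosedFieldType} {n} (x : 'rV[C]_n) : C :=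
  \sum_j `|x 0 j| ^+ 2.

Lemma sqnormE {C : numClosedFieldType} {n} (x : 'rV[C]_n) :
  sqnorm x = (x *m x ^t*) 0 0.
Proof. by rewrite mxE; apply: eq_bigr => j _; rewrite !mxE normCK. Qed.

Lemma sqnorm_unitary {C : numClosedFieldType} {n} (x : 'rV[C]_n) (P : 'M[C]_n) :
  P \is unitarymx -> sqnorm (x *m P) = sqnorm x.
Proof.
move=> /unitarymxP PP; rewrite !sqnormE trmx_mul map_mxM mulmxA.
by rewrite -(mulmxA x) PP mulmx1.
Qed.

(** In an orthonormal eigenbasis [A] multiplies each coordinate by an eigenvalue, and the unitary
    change of basis preserves [sqnorm]. One nonzero coordinate makes the inequality strict. *)
Lemma sqnorm_normal_lt {C : numClosedFieldType} {n} (A : 'M[C]_n) (r : C) :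
    A \is normalmx -> (forall a, eigenvalue A a -> `|a| ^+ 2 < r) ->
  forall x : 'rV_n, x != 0 -> sqnorm (x *m A) < r * sqnorm x.
Proof.
move=> nA ltr x x0.
have unP := spectral_unitarymx A.
have defA := orthomx_spectralP nA.
set P := spectralmx A in unP defA *; set D := spectral_diag A in defA *.
have uP : P \in unitmx by apply: unitarymx_unit.
(* Row [i] of [P] is an eigenvector for [D 0 i]; it is nonzero because [P] is invertible. *)
have lt_D i : `|D 0 i| ^+ 2 < r.
  apply: ltr; apply/eigenvalueP; exists (row i P).
    rewrite {1}defA !mulmxA -row_mul mulmxV // row1 -rowE row_diag_mx.
    by rewrite -scalemxAl -rowE.
  apply/eqP => Pi0; have := row_mul i P (invmx P).
  rewrite Pi0 mul0mx mulmxV // row1 => /rowP/(_ i)/eqP.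
  by rewrite !mxE !eqxx oner_eq0.
pose z := x *m invmx P.
have defx : x = z *m P by rewrite /z mulmxKV.
have z0 : z != 0 by apply: contraNneq x0 => z0; rewrite defx z0 mul0mx.
have -> : x *m A = z *m diag_mx D *m P by rewrite {1}defA !mulmxA.
clearbody z; rewrite {x x0}defx !(sqnorm_unitary _ unP).
rewrite /sqnorm mulr_sumr.
have [i zi0] : exists i, z 0 i != 0 by apply/rV0Pn.
rewrite (bigD1 i) //= [ltRHS](bigD1 i) //=.
have mulD j : `|(z *m diag_mx D) 0 j| ^+ 2 = `|D 0 j| ^+ 2 * `|z 0 j| ^+ 2.
  by rewrite mul_mx_diag mxE normrM exprMn mulrC.
apply: ltr_leD; first by rewrite mulD ltr_pM2r // exprn_gt0 // normr_gt0.
by apply: ler_sum => j _; rewrite mulD ler_wpM2r ?exprn_ge0 // ltW.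
Qed.

(* Exponent of ['i] in the entry of the Hermitian adjacency matrix at an adjacent pair. *)
Definition arc_exp (p q : bool) : nat := if p then (if q then 0 else 1) else 3.

(** * Sums of two powers of ['i] *)

Lemma prim_root_i : 4.-primitive_root ('i : algC).
Proof.
have i4 : ('i : algC) ^+ 4 = 1 by rewrite (exprM _ 2 2) sqrCi sqrrN expr1n.
have [m /[dup] pm m4] := prim_order_exists (isT : (0 < 4)%N) i4.
move=> /dvdn_leq -/(_ isT); move: pm m4.
have N11 : (-1 : algC) != 1 by rewrite eqNr oner_eq0.
have i2 : ('i : algC) ^+ 2 != 1 by rewrite sqrCi.
case: m => [|[|[|[|[|m]]]]] //.
- by move=> _ /prim_expr_order i1; move: i2; rewrite -['i]expr1 i1 expr1n eqxx.
- by move=> _ /prim_expr_order i1; move: i2; rewrite i1 eqxx.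
- move=> _ /prim_expr_order i1; move: i4 i2; rewrite exprSr i1 mul1r => ->.
  by rewrite expr1n eqxx.
Qed.

Lemma expi_add_eq0 (a b : nat) :
  (('i : algC) ^+ a + 'i ^+ b == 0) = (a == b + 2 %[mod 4]).
Proof. by rewrite -(eq_prim_root_expr prim_root_i) addr_eq0 exprD sqrCi mulrN1. Qed.

(** Up to a unit factor the sum is [1 + z] with [z] one of 1, ['i], -1, [- 'i]; the squared modulus
    is then 4, 2, 0 or 2. *)
Lemma expi_add_norm_lt2 (a b : nat) :
  `|('i : algC) ^+ a + 'i ^+ b| ^+ 2 < 2 -> ('i : algC) ^+ a + 'i ^+ b = 0.
Proof.
(* Modulo 4, adding [3 * a] to an exponent amounts to subtracting [a]. *)
have -> : ('i : algC) ^+ b = 'i ^+ a * 'i ^+ ((b + 3 * a) %% 4).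
  rewrite -exprD; apply/eqP; rewrite (eq_prim_root_expr prim_root_i) modnDmr.
  by rewrite addnCA -mulSn addnC mulnC modnMDl.
rewrite -{1 3}['i ^+ a]mulr1 -mulrDr normrM normrX normCi expr1n mul1r.
have : ((b + 3 * a) %% 4 < 4)%N by rewrite ltn_mod.
have n1i : `|1 + 'i| ^+ 2 = 2 :> algC.
  by rewrite normCK rmorphD rmorph1 /= conjCi mulrC -subr_sqr sqrCi expr1n opprK.
case: (_ %% 4)%N => [|[|[|[|k]]]] // _.
- by rewrite expr0 -[1 + 1]/(2%:R) normr_nat -natrX ltr_nat.
- by rewrite expr1 n1i ltxx.
- by rewrite sqrCi subrr mulr0.
- rewrite (exprSr 'i) sqrCi mulN1r -norm_conjC rmorphB rmorph1 /= conjCi opprK n1i.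
  by rewrite ltxx.
Qed.

(** * Entries of the Hermitian adjacency matrix and reality of its eigenvalues *)

Section HermitianAdjacency.
Variables (n : nat) (arc : rel 'I_n).
Hypothesis irr : forall v, ~~ arc v v.
Notation H := (herm_adj arc).
Notation E := (underlying arc).
Notation expo u v := (arc_exp (arc u v) (arc v u)).

Lemma underlyingE u v : E u v = arc u v || arc v u.
Proof. by []. Qed.

Lemma underlying_sym u v : E u v = E v u.
Proof. by rewrite !underlyingE orbC. Qed.

Lemma underlying_irr v : E v v = false.
Proof. by rewrite underlyingE (negPf (irr v)). Qed.

Lemma herm_adjE u v : E u v -> H u v = 'i ^+ expo u v.
Proof.
rewrite mxE underlyingE /arc_exp; case: (arc u v) (arc v u) => [] [] //= _.
by rewrite (exprSr 'i) sqrCi mulN1r.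
Qed.

Lemma herm_adj0 u v : ~~ E u v -> H u v = 0.
Proof. by rewrite mxE underlyingE; case: (arc u v) (arc v u) => [] []. Qed.

Lemma norm_herm_adj u v : `|H u v| = (E u v)%:R.
Proof.
case: (boolP (E u v)) => [uv|/herm_adj0->]; last by rewrite normr0.
by rewrite herm_adjE // normrX normCi expr1n.
Qed.

Lemma herm_adj_conj u v : (H u v)^* = H v u.
Proof.
rewrite !mxE; case: (arc u v) (arc v u) => [] [] /=.
- by rewrite rmorph1.
- by rewrite conjCi.
- by rewrite rmorphN /= conjCi opprK.
- by rewrite rmorph0.
Qed.

Lemma herm_adj_tC : H ^t* = H.
Proof. by apply/matrixP => u v; rewrite [LHS]mxE [X in X^* = _]mxE herm_adj_conj. Qed.

Lemma herm_adj_normal : H \is normalmx.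
Proof. by apply/normalmxP; rewrite herm_adj_tC. Qed.

Lemma herm_adj_mulC u v : E u v -> H u v * H v u = 1.
Proof. by move=> uv; rewrite -(herm_adj_conj u) -normCK norm_herm_adj uv expr1n. Qed.

(** The form [v *m H *m v ^t*] equals both [a] and [a^*] times the nonzero real number
    [sqnorm v]. *)
Lemma eigenvalue_herm_adj_real a : eigenvalue H a -> a \is Num.real.
Proof.
move=> /eigenvalueP[v vH v0].
have [i vi0] : exists i, v 0 i != 0 by apply/rV0Pn.
have nv : sqnorm v != 0.
  apply/eqP => /psumr_eq0P-/(_ (fun j _ => exprn_ge0 2 (normr_ge0 _)))/(_ i isT)/eqP.
  by rewrite sqrf_eq0 normr_eq0 (negPf vi0).
have nR : (sqnorm v)^* = sqnorm v.
  by apply/CrealP/ger0_real/sumr_ge0 => j _; apply: exprn_ge0.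
have e : v *m H *m v ^t* = a *: (v *m v ^t*) by rewrite vH scalemxAl.
have e' : v *m H *m v ^t* = a^* *: (v *m v ^t*).
  have := congr1 (fun M : 'M[algC]_1 => M ^t*) e.
  rewrite !trmx_mul !map_mxM trmxCK herm_adj_tC mulmxA => ->.
  apply/matrixP => p q; rewrite !ord1 [LHS]mxE [in LHS]mxE mxE [RHS]mxE rmorphM /=.
  by rewrite -[X in _ * X^*]sqnormE nR sqnormE.
apply/CrealP; apply: (mulIf nv).
have /matrixP/(_ 0 0) := e'; rewrite e [LHS]mxE [RHS]mxE -sqnormE => ->.
by [].
Qed.

Definition nbr u : {set 'I_n} := [set w | E u w].

Lemma in_nbr u w : (w \in nbr u) = E u w.
Proof. by rewrite inE. Qed.

Lemma sqnorm_ge_part (x : 'rV[algC]_n) (A : {set 'I_n}) :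
  \sum_(j in A) `|x 0 j| ^+ 2 <= sqnorm x.
Proof.
rewrite /sqnorm [leRHS](bigID (mem A)) /= lerDl.
by apply: sumr_ge0 => j _; apply: exprn_ge0.
Qed.

(** * Local restrictions on the graph, obtained from test vectors *)

Section Contraction.
Hypothesis contr : forall x : 'rV_n, x != 0 -> sqnorm (x *m H) < 3 * sqnorm x.

Lemma sqnorm_delta u : sqnorm (delta_mx 0 u : 'rV[algC]_n) = 1.
Proof.
rewrite /sqnorm (bigD1 u) //= big1 => [|j ju].
  by rewrite mxE !eqxx normr1 expr1n addr0.
by rewrite mxE (negPf ju) andbF normr0 expr0n.
Qed.

(** The image of the basis vector at [u] is row [u] of [H], whose entries have modulus 0 or 1; its
    squared norm counts the neighbours and must be below 3. *)
Lemma card_nbr_le2 u : (#|nbr u| <= 2)%N.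
Proof.
have d0 : delta_mx 0 u != 0 :> 'rV[algC]_n.
  by apply/rV0Pn; exists u; rewrite mxE !eqxx oner_eq0.
have := contr d0; rewrite sqnorm_delta mulr1 -rowE /sqnorm.
under eq_bigr => j _ do rewrite mxE norm_herm_adj -natrX.
rewrite -natr_sum ltr_nat -[(_ <= 2)%N]ltnS; apply: leq_ltn_trans.
rewrite -sum1_card big_mkcond /=; apply: leq_sum => j _.
by rewrite in_nbr; case: (E u j).
Qed.

(* Test vector: [delta_u + c delta_v], the unit [c] aligning the two walks through [w]. *)
Lemma common_nbr_cancel u v w p q : u != v -> w != p -> w != q ->
    nbr u = [set w; p] -> nbr v = [set w; q] ->
  p = q /\ H u w * H w v + H u p * H p v = 0.
Proof.
move=> uv wp wq Nu Nv.
have uw : E u w by rewrite -in_nbr Nu !inE eqxx.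
have up : E u p by rewrite -in_nbr Nu !inE eqxx orbT.
have vw : E v w by rewrite -in_nbr Nv !inE eqxx.
have vq : E v q by rewrite -in_nbr Nv !inE eqxx orbT.
pose c := H u w * H w v; pose x : 'rV[algC]_n := delta_mx 0 u + c *: delta_mx 0 v.
have nc : `|c| = 1 by rewrite normrM !norm_herm_adj uw underlying_sym vw mulr1.
have nx : sqnorm x = 2.
  rewrite /sqnorm (bigD1 u) //= (bigD1 v) ?(eq_sym v) //= big1 => [|j].
    rewrite !mxE !eqxx (negPf uv) eq_sym (negPf uv) /= mulr0 !addr0 add0r mulr1.
    by rewrite nc normr1 expr1n.
  by case/andP=> ju jv; rewrite !mxE (negPf ju) (negPf jv) mulr0 addr0 normr0 expr0n.
have x0 : x != 0.
  apply/eqP => x0; move: nx; rewrite x0 /sqnorm big1 => [/eqP|j _].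
    by rewrite eq_sym pnatr_eq0.
  by rewrite mxE normr0 expr0n.
have y j : (x *m H) 0 j = H u j + c * H v j.
  by rewrite mulmxDl -scalemxAl -!rowE !mxE.
(* By the choice of [c], both terms of this coordinate equal [H u w]. *)
have yw : `|(x *m H) 0 w| ^+ 2 = 4.
  rewrite y /c -mulrA herm_adj_mulC ?[E w v]underlying_sym // mulr1 -mulr2n.
  by rewrite normrMn norm_herm_adj uw -natrX.
have := contr x0; rewrite nx -natrM => lt6.
(* If [p] and [q] differ, each receives a single term of modulus 1, so the coordinates [w], [p], [q]
   contribute 4 + 1 + 1 and exhaust the strict bound 6. *)
case: (eqVneq p q) => [pq|npq]; last first.
  have vp : H v p = 0 by apply: herm_adj0; rewrite -in_nbr Nv !inE eq_sym (negPf wp).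
  have uq : H u q = 0.
    by apply: herm_adj0; rewrite -in_nbr Nu !inE eq_sym (negPf wq) eq_sym.
  have := le_lt_trans (sqnorm_ge_part _ [set w; p; q]) lt6.
  rewrite -setUA big_setU1 ?inE ?negb_or ?wp //= big_setU1 ?inE //= big_set1 yw.
  rewrite !y vp uq mulr0 addr0 add0r normrM nc !norm_herm_adj up vq mul1r expr1n.
  by rewrite -[1 + 1]/(2%:R) -natrD ltxx.
split=> //; subst q.
(* The coordinate at [w] takes 4 of the 6, so the one at [p] has squared modulus below 2; up to a
   unit it is a sum of two powers of ['i], hence zero. *)
have := le_lt_trans (sqnorm_ge_part _ [set w; p]) lt6.
rewrite big_setU1 ?inE //= big_set1 yw -ltrBrDl -natrB // y => lt2.
have wv : E w v by rewrite underlying_sym.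
have pv : E p v by rewrite underlying_sym.
rewrite !herm_adjE // -!exprD; apply: expi_add_norm_lt2.
rewrite !exprD -!herm_adjE //.
suff -> : H u w * H w v + H u p * H p v = (H u p + c * H v p) * H p v.
  by rewrite normrM norm_herm_adj pv mulr1.
by rewrite mulrDl -mulrA herm_adj_mulC // mulr1 addrC.
Qed.

End Contraction.
End HermitianAdjacency.

(** Lets an isomorphism be given by listing the vertices; [index] supplies the preimages. *)
Lemma iso_on_seq (n m : nat) (r : rel 'I_n) (G : rel 'I_m) (C : {set 'I_n})
    (s : seq 'I_n) (x0 : 'I_n) :
    uniq s -> size s = m -> C =i s ->
    (forall i j : 'I_m, r (nth x0 s i) (nth x0 s j) = G i j) ->
  iso_on r C G.
Proof.
move=> Us sm; subst m => Cs rG; exists (fun i => nth x0 s i); split.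
  by move=> i j /eqP; rewrite nth_uniq // => /eqP/val_inj.
split=> //; apply/setP => y; rewrite Cs; apply/imsetP/idP.
  by case=> i _ ->; rewrite mem_nth.
move=> ys; have ltis : (index y s < size s)%N by rewrite index_mem.
by exists (Ordinal ltis); rewrite // nth_index.
Qed.

(** * Weak components, and orientations of a 4-cycle *)

Section Components.
Variables (n : nat) (arc : rel 'I_n).
Hypothesis irr : forall v, ~~ arc v v.
Notation E := (underlying arc).
Notation expo u v := (arc_exp (arc u v) (arc v u)).

Lemma connect_underlying_sym : connect_sym E.
Proof. by apply: sym_connect_sym => u v; rewrite underlying_sym. Qed.

Lemma component_closed (C : {set 'I_n}) x y :
  weak_component arc C -> x \in C -> E x y -> y \in C.
Proof.
by case=> z ->; rewrite !inE => zx xy; apply: connect_trans zx (connect1 xy).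
Qed.

Lemma componentE (C : {set 'I_n}) x :
  weak_component arc C -> x \in C -> C = [set y | connect E x y].
Proof.
case=> z ->; rewrite inE => zx; apply/setP => y; rewrite !inE.
exact: (same_connect connect_underlying_sym zx).
Qed.

(** Closure under adjacency keeps every path from [x] inside [s]; the last hypothesis gives the
    other inclusion. *)
Lemma component_eq (C : {set 'I_n}) (s : seq 'I_n) x :
    weak_component arc C -> x \in C -> x \in s ->
    (forall u v, u \in s -> E u v -> v \in s) ->
    {in s, forall u, connect E x u} ->
  C =i s.
Proof.
move=> compC xC xs cls conn y; rewrite (componentE compC xC) inE.
apply/idP/idP => [/connectP[p]|]; last exact: conn.
elim: p x xs {xC conn} => [|z p IHp] x xs /=; first by move=> _ ->.
by case/andP=> xz; apply: IHp; apply: cls xz.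
Qed.

(** Take the first arc leaving [S] on a directed path from [x] to [y]. *)
Lemma strongly_connected_cut (C S : {set 'I_n}) x y :
    strongly_connected_on arc C -> x \in C -> y \in C -> x \in S -> y \notin S ->
  exists u v, [/\ u \in S, v \notin S, v \in C & arc u v].
Proof.
move=> sC xC yC xS yS; case/connectP: (sC x y xC yC) => p.
elim: p x xC xS => [|z p IHp] x xC xS /=; first by move=> _ yx; rewrite yx xS in yS.
case/andP=> /and3P[xz _ zC]; case: (boolP (z \in S)) => zS; first exact: IHp.
by exists x, z.
Qed.

(** A chordless 4-cycle with a chosen start and direction of traversal; rotation and reversal give
    its eight labellings. *)
Definition square a b c d :=
  [&& uniq [:: a; b; c; d], E a b, E b c, E c d, E d a, ~~ E a c & ~~ E b d].

Lemma square_rot a b c d : square a b c d -> square b c d a.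
Proof.
case/and5P=> U ab bc cd /and3P[da ac bd]; rewrite /square ab bc cd da bd.
rewrite [E c a]underlying_sym ac !andbT.
by have := rot_uniq 1 [:: a; b; c; d]; rewrite U.
Qed.

Lemma square_rev a b c d : square a b c d -> square d c b a.
Proof.
case/and5P=> U ab bc cd /and3P[da ac bd]; rewrite /square.
rewrite ![_ d c]underlying_sym ![_ c b]underlying_sym ![_ b a]underlying_sym.
rewrite [_ a d]underlying_sym [_ d b]underlying_sym [_ c a]underlying_sym.
by rewrite ab bc cd da ac bd !andbT; have := rev_uniq [:: a; b; c; d]; rewrite U.
Qed.

(** The negated arcs exclude digons, since [iso_on] demands equality of relations; the diagonals are
    left to [square]. *)
Definition ctilde4_arcs a b c d :=
  [&& arc a b, ~~ arc b a, arc b c, ~~ arc c b, arc c d, ~~ arc d c, arc a d & ~~ arc d a].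

Definition digon a b := arc a b && arc b a.
Definition digons4 a b c d :=
  (digon a b + digon b c + digon c d + digon d a)%N.
Definition directed_cycle4 a b c d := [&& arc a b, arc b c, arc c d & arc d a].

(** The walks [a b c] and [a d c] have opposite weights, the offset 2 standing for the factor -1.
    Equivalently, the cycle has weight -1. *)
Definition cancels a b c d :=
  expo a b + expo b c == expo a d + expo d c + 2 %[mod 4].

(** Going round the cycle, a digon counts 0 and an arc 1 or -1 by its direction. The total is 2
    modulo 4, hence 2 or -2: either three arcs run one way and one the other, or there are two
    digons and two arcs running the same way. The first case is [ctilde4] in one of eight
    labellings. The proof enumerates the orientations. *)
Lemma cancels_cases a b c d : square a b c d -> cancels a b c d ->
  [|| ctilde4_arcs a b c d, ctilde4_arcs b c d a, ctilde4_arcs c d a b,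
      ctilde4_arcs d a b c, ctilde4_arcs d c b a, ctilde4_arcs c b a d,
      ctilde4_arcs b a d c, ctilde4_arcs a d c b
    | (digons4 a b c d == 2) &&
      (directed_cycle4 a b c d || directed_cycle4 d c b a)].
Proof.
case/and5P=> _; rewrite !underlyingE => + + + /and3P[+ _ _].
rewrite /cancels /ctilde4_arcs /directed_cycle4 /digons4 /digon.
case: (arc a b) (arc b a) => [] [] //= _;
case: (arc b c) (arc c b) => [] [] //= _;
case: (arc c d) (arc d c) => [] [] //= _;
by case: (arc d a) (arc a d) => [] [].
Qed.

Lemma ctilde4_arcs_cancels a b c d : ctilde4_arcs a b c d -> cancels a b c d.
Proof.
rewrite /cancels /ctilde4_arcs.
by case/and5P=> -> /negPf-> -> /negPf-> /and4P[-> /negPf-> -> /negPf->].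
Qed.

Lemma square_in (C : {set 'I_n}) a b c d : C =i [:: a; b; c; d] ->
  [/\ a \in C, b \in C, c \in C & d \in C].
Proof. by move=> Cs; rewrite !Cs !inE !eqxx !orbT. Qed.

(** Some arc must leave each of the sets [a]; [b, c, d]; and [a, b]. As there are no chords, only
    the arcs listed can do so. *)
Lemma square_strong_cuts (C : {set 'I_n}) a b c d :
    square a b c d -> C =i [:: a; b; c; d] -> strongly_connected_on arc C ->
  [&& arc a b || arc a d, arc b a || arc d a & arc a d || arc b c].
Proof.
move=> sq Cs sC; have [aC bC cC dC] := square_in Cs.
case/and5P: sq => U ab bc cd /and3P[da]; rewrite !underlyingE !negb_or.
case/andP=> /negPf nac /negPf nca /andP[/negPf nbd /negPf ndb].
move: U; rewrite /= !inE !negb_or -!andbA => /and5P[nab nac' nad nbc /andP[nbd' /andP[ncd _]]].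
apply/and3P; split.
- have [] := strongly_connected_cut (S := [set a]) sC aC bC.
  + by rewrite inE.
  + by rewrite inE eq_sym.
  move=> u [v [+ + +]]; rewrite Cs !inE => /eqP-> va.
  by rewrite (negPf va) /= => /or3P[]/eqP-> ; rewrite ?nac // => ->; rewrite ?orbT.
- have [] := strongly_connected_cut (S := [set b; c; d]) sC bC aC.
  + by rewrite !inE eqxx.
  + by rewrite !inE !negb_or nab nac' nad.
  move=> u [v [+ + +]]; rewrite Cs !inE !negb_or -!andbA -!orbA => su.
  case/and3P=> /negPf-> /negPf-> /negPf->; rewrite !orbF => /eqP->.
  by case/or3P: su => /eqP->; rewrite ?nca // => ->; rewrite ?orbT.
- have [] := strongly_connected_cut (S := [set a; b]) sC aC cC.
  + by rewrite !inE eqxx.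
  + by rewrite !inE !negb_or ![c == _]eq_sym nac' nbc.
  move=> u [v [+ + +]]; rewrite Cs !inE !negb_or => su.
  case/andP=> /negPf-> /negPf->; rewrite /=.
  case/orP=> /eqP->; case/orP: su => /eqP->; rewrite ?nac ?nbd // => ->;
  by rewrite ?orbT.
Qed.

(** Two arcs running opposite ways round the cycle, with digons elsewhere, would be the only edges
    crossing some cut that is crossed in one direction at most in part. *)
Lemma strong_cancels (C : {set 'I_n}) a b c d :
    square a b c d -> C =i [:: a; b; c; d] -> strongly_connected_on arc C ->
  digons4 a b c d = 2%N -> cancels a b c d.
Proof.
move=> sq0 C0 sC.
have rotC u v w z : C =i [:: u; v; w; z] -> C =i [:: v; w; z; u].
  by move=> Cs y; rewrite Cs -(mem_rot 1).
have sq1 := square_rot sq0; have C1 := rotC _ _ _ _ C0.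
have sq2 := square_rot sq1; have C2 := rotC _ _ _ _ C1.
have sq3 := square_rot sq2; have C3 := rotC _ _ _ _ C2.
(* The four rotations supply the cuts at every vertex and at every pair of adjacent vertices; the
   remaining orientations are enumerated. *)
move: (square_strong_cuts sq0 C0 sC) (square_strong_cuts sq1 C1 sC).
move: (square_strong_cuts sq2 C2 sC) (square_strong_cuts sq3 C3 sC).
case/and5P: sq0 => _; rewrite !underlyingE => + + + /and3P[+ _ _].
rewrite /cancels /digons4 /digon.
case: (arc a b) (arc b a) => [] [] //= _;
case: (arc b c) (arc c b) => [] [] //= _;
case: (arc c d) (arc d c) => [] [] //= _;
by case: (arc d a) (arc a d) => [] [].
Qed.

Lemma num_digons_square (C : {set 'I_n}) a b c d :
  square a b c d -> C =i [:: a; b; c; d] -> num_digons arc C = digons4 a b c d.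
Proof.
move=> sq Cs.
(* As a double sum over [C], the count can be expanded along the list of the four vertices. *)
transitivity (\sum_(u in C) \sum_(v in C) ((u < v) && digon u v))%N.
  rewrite pair_big /= /num_digons -sum1_card big_mkcond [RHS]big_mkcond /=.
  apply: eq_bigr => -[u v] _; rewrite inE /= /digon.
  by case: (u < v)%N (arc u v) (arc v u) (u \in C) (v \in C) => [] [] [] [] [].
case/and5P: sq => U ab bc cd /and3P[da]; rewrite !underlyingE !negb_or.
case/andP=> /negPf nac /negPf nca /andP[/negPf nbd /negPf ndb].
rewrite (eq_bigl _ _ Cs) -big_uniq //=.
under eq_bigr => u _ do rewrite (eq_bigl _ _ Cs) -big_uniq //=.
rewrite !big_cons !big_nil !ltnn /= ![digon a c]/digon ![digon c a]/digon.
rewrite ![digon b d]/digon ![digon d b]/digon nac nca nbd ndb !andbF.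
(* Exactly one of [u < v] and [v < u] holds, so a digon is counted once, in whichever order the
   numbering of its ends dictates. *)
have dig u v : u != v -> digon u v = ((u < v) && digon u v + (v < u) && digon v u)%N :> nat.
  rewrite -val_eqE /= [digon v u]andbC -/(digon u v).
  by case: ltngtP => //=; rewrite ?addn0.
move: U; rewrite /= !inE !negb_or -!andbA => /and5P[nab _ nad nbc /andP[_ /andP[ncd _]]].
rewrite /digons4 (dig a b) // (dig b c) // (dig c d) // (dig d a) 1?eq_sym //.
rewrite !addn0 !add0n; ring.
Qed.

Lemma directed_cycle4_strong (C : {set 'I_n}) a b c d :
    C =i [:: a; b; c; d] -> directed_cycle4 a b c d -> strongly_connected_on arc C.
Proof.
move=> Cs /and4P[ab bc cd da]; have [aC bC cC dC] := square_in Cs.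
pose e := [rel u v | [&& arc u v, u \in C & v \in C]].
have eab : connect e a b by apply: connect1; rewrite /= ab aC.
have ebc : connect e b c by apply: connect1; rewrite /= bc bC.
have ecd : connect e c d by apply: connect1; rewrite /= cd cC.
have eda : connect e d a by apply: connect1; rewrite /= da dC.
have eac := connect_trans eab ebc; have ead := connect_trans eac ecd.
have eca := connect_trans ecd eda; have eba := connect_trans ebc eca.
move=> x y; rewrite !Cs !inE => xs ys.
(* All connections are routed through [a]. *)
apply: (@connect_trans _ _ a).
  by case/or4P: xs => /eqP->.
by case/or4P: ys => /eqP->.
Qed.

Lemma iso_on_square (C : {set 'I_n}) a b c d :
  square a b c d -> C =i [:: a; b; c; d] -> iso_on E C cycle4.
Proof.
case/and5P=> U ab bc cd /and3P[da /negPf ac /negPf bd] Cs.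
apply: (iso_on_seq (x0 := a) U _ Cs) => //.
by move=> [[|[|[|[|i]]]] // Hi] [[|[|[|[|j]]]] // Hj];
  rewrite /cycle4 /= ?underlying_irr // ?ab ?bc ?cd ?da ?ac ?bd // underlying_sym.
Qed.

Lemma iso_on_ctilde4 (C : {set 'I_n}) a b c d :
    square a b c d -> C =i [:: a; b; c; d] -> ctilde4_arcs a b c d ->
  iso_on arc C ctilde4.
Proof.
case/and5P=> U _ _ _ /and3P[_]; rewrite !underlyingE !negb_or.
case/andP=> /negPf nac /negPf nca /andP[/negPf nbd /negPf ndb] Cs.
case/and5P=> ab /negPf ba bc /negPf cb /and4P[cd /negPf dc ad /negPf da].
apply: (iso_on_seq (x0 := a) U _ Cs) => //.
by move=> [[|[|[|[|i]]]] // Hi] [[|[|[|[|j]]]] // Hj];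
  rewrite /ctilde4 /= ?(negPf (irr _)) // ?ab ?ba ?bc ?cb ?cd ?dc ?ad ?da ?nac ?nca ?nbd ?ndb.
Qed.

(** Each case of [cancels_cases] becomes the standard one after relabelling the square by a rotation
    or reflection. *)
Lemma square_good (C : {set 'I_n}) a b c d :
    square a b c d -> C =i [:: a; b; c; d] -> cancels a b c d ->
  good_component arc C.
Proof.
move=> sq Cs can; right; split; first exact: iso_on_square sq Cs.
have rotC u v w z : C =i [:: u; v; w; z] -> C =i [:: v; w; z; u].
  by move=> C' y; rewrite C' -(mem_rot 1).
have revC u v w z : C =i [:: u; v; w; z] -> C =i [:: z; w; v; u].
  by move=> C' y; rewrite C' -mem_rev.
have ct u v w z := @iso_on_ctilde4 C u v w z.
have s1 := square_rot sq; have C1 := rotC _ _ _ _ Cs.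
have s2 := square_rot s1; have C2 := rotC _ _ _ _ C1.
have s3 := square_rot s2; have C3 := rotC _ _ _ _ C2.
case/or4P: (cancels_cases sq can) => [||| /or4P[|||/or3P[||/andP[/eqP d2 dc]]]].
- by left; apply: ct sq Cs _.
- by left; apply: ct s1 C1 _.
- by left; apply: ct s2 C2 _.
- by left; apply: ct s3 C3 _.
- by left; apply: ct (square_rev sq) (revC _ _ _ _ Cs) _.
- by left; apply: ct (square_rev s3) (revC _ _ _ _ C3) _.
- by left; apply: ct (square_rev s2) (revC _ _ _ _ C2) _.
- by left; apply: ct (square_rev s1) (revC _ _ _ _ C1) _.
right; rewrite (num_digons_square sq Cs); split=> //.
case/orP: dc; first exact: directed_cycle4_strong.
exact: directed_cycle4_strong (revC _ _ _ _ Cs).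
Qed.

End Components.

(** * Components allowed by the contraction bound *)

Section Classification.
Variables (n : nat) (arc : rel 'I_n).
Hypothesis irr : forall v, ~~ arc v v.
Notation H := (herm_adj arc).
Notation E := (underlying arc).
Notation N := (nbr arc).

Lemma nbr1E u w : (#|N u| <= 2)%N -> #|N u| != 2%N -> E u w -> N u = [set w].
Proof.
move=> le2 ne2 uw; apply/esym/eqP; rewrite eqEcard sub1set in_nbr uw cards1 /=.
by move: le2 ne2; case: #|N u| => [|[|[|]]].
Qed.

Lemma nbr2E u w : #|N u| = 2%N -> E u w -> exists2 p, w != p & N u = [set w; p].
Proof.
rewrite -in_nbr => Nu2 wN; have := cardsD1 w (N u); rewrite Nu2 wN => -[] /esym/eqP.
case/cards1P => p Np; exists p; last by rewrite -(setD1K wN) Np.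
by have := set11 p; rewrite -Np !inE eq_sym; case/andP.
Qed.

Section Forward.
Hypothesis contr : forall x : 'rV_n, x != 0 -> sqnorm (x *m H) < 3 * sqnorm x.
Variable C : {set 'I_n}.
Hypothesis compC : weak_component arc C.

Let le2 u : (#|N u| <= 2)%N := card_nbr_le2 contr u.

(** By [common_nbr_cancel] the other neighbours of [u] and [v] coincide in some [p]. The degree
    bound closes up the cycle [u w v p], and the opposite walk weights are exactly [cancels]. *)
Lemma good_of_two_deg2 u v w : u \in C -> u != v -> E u w -> E v w ->
  #|N u| = 2%N -> #|N v| = 2%N -> good_component arc C.
Proof.
move=> uC uv uw vw Nu2 Nv2.
have [p wp Nu] := nbr2E Nu2 uw; have [q wq Nv] := nbr2E Nv2 vw.
have [pq] := common_nbr_cancel contr uv wp wq Nu Nv; subst q.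
have up : E u p by rewrite -in_nbr Nu !inE eqxx orbT.
have vp : E v p by rewrite -in_nbr Nv !inE eqxx orbT.
have wv : E w v by rewrite underlying_sym.
have pv : E p v by rewrite underlying_sym.
have wu : E w u by rewrite underlying_sym.
have pu : E p u by rewrite underlying_sym.
have neq x y : E x y -> x != y by apply: contraTneq => ->; rewrite underlying_irr.
(* A vertex adjacent to both [u] and [v] has no room for further neighbours; this serves for [w] and
   [p]. *)
have Nx x : E x u -> E x v -> N x = [set u; v].
  move=> xu xv; apply/esym/eqP; rewrite eqEcard cards2 uv le2 andbT.
  by apply/subsetP => y; rewrite !inE => /orP[]/eqP->.
have sq : square arc u w v p.
  have U : uniq [:: u; w; v; p].
    by rewrite /= !inE !negb_or (neq _ _ uw) uv (neq _ _ up) (neq _ _ wv) wp (neq _ _ vp).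
  rewrite /square U uw wv vp pu -!in_nbr Nu (Nx w wu wv) !inE !negb_or.
  by rewrite (neq _ _ vw) (neq _ _ vp) (neq _ _ pu) (neq _ _ pv).
move=> H0; apply: (square_good irr sq).
  apply: (component_eq compC uC); first by rewrite inE eqxx.
    move=> x y + xy; rewrite !inE => xs; move: xs xy; rewrite -in_nbr.
    by case/or4P=> /eqP->; rewrite ?Nu ?Nv ?Nx // !inE => /orP[]/eqP->; rewrite eqxx ?orbT.
  move=> x; rewrite !inE => /or4P[]/eqP-> //; try exact: connect1.
  exact: connect_trans (connect1 uw) (connect1 wv).
by rewrite /cancels -expi_add_eq0 !exprD -!herm_adjE // H0.
Qed.

Lemma iso_on_path (s : seq 'I_n) (k : nat) x0 :
    uniq s -> size s = k.+1 -> C =i s ->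
    (forall i j, (i < k.+1)%N -> (j < k.+1)%N ->
      E (nth x0 s i) (nth x0 s j) = (i.+1 == j) || (j.+1 == i)) ->
  iso_on E C (@path_graph k).
Proof. by move=> Us sk Cs pE; apply: (iso_on_seq (x0 := x0) Us sk Cs) => i j; apply: pE. Qed.

(** The component is explored from the end [a] through [b] and [c] to a possible [d], and the path
    cannot continue beyond [d]. *)
Lemma good_of_deg2_leaf a b c : b \in C -> N b = [set a; c] -> a != c -> N a = [set b] ->
  good_component arc C.
Proof.
move=> bC Nb nac Na.
have neq x y : E x y -> (x == y) = false.
  by move=> xy; apply/negbTE; apply: contraTneq xy => ->; rewrite underlying_irr.
have ba : E b a by rewrite -in_nbr Nb !inE eqxx.
have bc : E b c by rewrite -in_nbr Nb !inE eqxx orbT.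
have ab : E a b by rewrite underlying_sym.
have cb : E c b by rewrite underlying_sym.
have Eb y : E b y = (y == a) || (y == c) by rewrite -in_nbr Nb !inE.
have Ea y : E a y = (y == b) by rewrite -in_nbr Na !inE.
have nac' := negPf nac; have nca' : (c == a) = false by rewrite eq_sym.
have aC := component_closed compC bC ba; have cC := component_closed compC bC bc.
have [Nc2|Nc2] := eqVneq #|N c| 2%N.
  have [d bd Nc] := nbr2E Nc2 cb.
  have cd : E c d by rewrite -in_nbr Nc !inE eqxx orbT.
  have dc : E d c by rewrite underlying_sym.
  (* If [d] had degree 2, then [b] and [d] would be two vertices of degree 2 with common neighbour
     [c], a case already settled. *)
  have [Nd2|Nd2] := eqVneq #|N d| 2%N.
    apply: (good_of_two_deg2 bC bd bc dc) => //.
    by rewrite Nb cards2 nac.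
  have Nd := nbr1E (le2 d) Nd2 dc.
  have Ec y : E c y = (y == b) || (y == d) by rewrite -in_nbr Nc !inE.
  have Ed y : E d y = (y == c) by rewrite -in_nbr Nd !inE.
  (* Otherwise [b], being adjacent to [a], would be the only neighbour [c] of [d]. *)
  have nad : (a == d) = false.
    apply: contraFF (neq _ _ bc) => /eqP ad.
    by move: (Ed b); rewrite -ad ab => <-.
  have nda : (d == a) = false by rewrite eq_sym.
  have ndb : (d == b) = false by rewrite eq_sym (negPf bd).
  left; exists 3%N; split=> //; apply: (iso_on_path (s := [:: a; b; c; d]) (x0 := a)) => //.
  - by rewrite /= !inE (neq _ _ ab) nac' nad (neq _ _ bc) (negPf bd) (neq _ _ cd).
  - apply: (component_eq compC aC); first by rewrite inE eqxx.
      move=> x y + xy; rewrite !inE => xs; move: xs xy.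
      by case/or4P=> /eqP->; rewrite ?Ea ?Eb ?Ec ?Ed; do ?case/orP;
        move=> /eqP->; rewrite eqxx ?orbT.
    have ac := connect_trans (connect1 ab) (connect1 bc).
    have ad := connect_trans ac (connect1 cd).
    by move=> x; rewrite !inE => /or4P[]/eqP-> //; apply: connect1.
  move=> [|[|[|[|i]]]] // [|[|[|[|j]]]] // _ _ /=; rewrite ?Ea ?Eb ?Ec ?Ed ?eqxx ?orbT //;
  by rewrite ?nac' ?nca' ?nad ?nda ?ndb ?(negPf bd) ?(neq _ _ ab) ?(neq _ _ ba) ?(neq _ _ bc)
    ?(neq _ _ cb) ?(neq _ _ cd) ?(neq _ _ dc).
have Nc := nbr1E (le2 c) Nc2 cb.
have Ec y : E c y = (y == b) by rewrite -in_nbr Nc !inE.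
left; exists 2%N; split=> //; apply: (iso_on_path (s := [:: a; b; c]) (x0 := a)) => //.
- by rewrite /= !inE (neq _ _ ab) nac' (neq _ _ bc).
- apply: (component_eq compC aC); first by rewrite inE eqxx.
    move=> x y + xy; rewrite !inE => xs; move: xs xy.
    by case/or3P=> /eqP->; rewrite ?Ea ?Eb ?Ec; do ?case/orP; move=> /eqP->; rewrite eqxx ?orbT.
  have ac := connect_trans (connect1 ab) (connect1 bc).
  by move=> x; rewrite !inE => /or3P[]/eqP-> //; apply: connect1.
move=> [|[|[|i]]] // [|[|[|j]]] // _ _ /=; rewrite ?Ea ?Eb ?Ec ?eqxx ?orbT //;
by rewrite ?nac' ?nca' ?(neq _ _ ab) ?(neq _ _ ba) ?(neq _ _ bc) ?(neq _ _ cb).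
Qed.

(** Around a vertex [b] of degree 2, either some neighbour is an end, or both neighbours have degree
    2 and share [b]. Without vertices of degree 2 the component is a point or an edge. *)
Lemma good_of_contraction : good_component arc C.
Proof.
have [x xC] : exists x, x \in C by case: compC => x ->; exists x; rewrite inE connect0.
have neq u v : E u v -> (u == v) = false.
  by move=> uv; apply/negbTE; apply: contraTneq uv => ->; rewrite underlying_irr.
case: (boolP [exists b in C, #|N b| == 2%N]) => [/exists_inP[b bC /eqP Nb2]|/exists_inPn no2].
  have /eqP/cards2P[a [c [nac Nb]]] := Nb2.
  have ba : E b a by rewrite -in_nbr Nb !inE eqxx.
  have bc : E b c by rewrite -in_nbr Nb !inE eqxx orbT.
  have aC := component_closed compC bC ba.
  have [Na2|Na2] := eqVneq #|N a| 2%N; last first.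
    apply: (good_of_deg2_leaf bC Nb nac); apply: nbr1E => //.
    by rewrite underlying_sym.
  have [Nc2|Nc2] := eqVneq #|N c| 2%N; last first.
    apply: (good_of_deg2_leaf (a := c) (c := a) bC); rewrite 1?setUC 1?eq_sym //.
    by apply: nbr1E => //; rewrite underlying_sym.
  by apply: (good_of_two_deg2 aC nac (w := b)); rewrite // underlying_sym.
case: (set_0Vmem (N x)) => [Nx|[y]]; last rewrite in_nbr => xy.
  left; exists 0%N; split=> //; apply: (iso_on_path (s := [:: x]) (x0 := x)) => //.
    apply: (component_eq compC xC); first by rewrite inE eqxx.
      by move=> u v; rewrite inE => /eqP->; rewrite -in_nbr Nx inE.
    by move=> u; rewrite inE => /eqP->.
  by move=> [|i] // [|j] // _ _; rewrite /= underlying_irr.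
have yx : E y x by rewrite underlying_sym.
have yC := component_closed compC xC xy.
have Nx := nbr1E (le2 x) (no2 x xC) xy; have Ny := nbr1E (le2 y) (no2 y yC) yx.
left; exists 1%N; split=> //; apply: (iso_on_path (s := [:: x; y]) (x0 := x)) => //.
- by rewrite /= !inE (neq _ _ xy).
- apply: (component_eq compC xC); first by rewrite inE eqxx.
    move=> u v + uv; rewrite !inE => us; move: us uv; rewrite -in_nbr.
    by case/orP=> /eqP->; rewrite ?Nx ?Ny inE => /eqP->; rewrite eqxx ?orbT.
  by move=> u; rewrite !inE => /orP[]/eqP-> //; apply: connect1.
by move=> [|[|i]] // [|[|j]] // _ _; rewrite /= ?underlying_irr.
Qed.

End Forward.
End Classification.

(** Meant for moduli of eigenvector entries along a path. Eliminating the other unknowns leaves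
    [(b ^+ 4 - 3 * b ^+ 2 + 1) * y1 <= 0]; the factor is the characteristic polynomial of the path
    on four vertices and is at least 1 when [b ^+ 2] is at least 3. *)
Lemma path_growth_eq0 (R : numDomainType) (b y0 y1 y2 y3 : R) :
    3 <= b ^+ 2 -> 0 <= b -> 0 <= y1 ->
    b * y0 <= y1 -> b * y1 <= y0 + y2 -> b * y2 <= y1 + y3 -> b * y3 <= y2 ->
  y1 = 0.
Proof.
move=> b3 b0 y1_ge0; rewrite -![_ * _ <= _]subr_ge0 => h0 h1 h2 h3.
have t3 : 0 <= b ^+ 2 - 3 by rewrite subr_ge0.
have t1 : 0 <= b ^+ 2 - 1.
  by rewrite subr_ge0 (le_trans _ b3) // ler1n.
have e1 : 0 <= b * (y0 + y2 - b * y1) + (y1 - b * y0) by rewrite addr_ge0 // mulr_ge0.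
have e2 : 0 <= b * (y1 + y3 - b * y2) + (y2 - b * y3) by rewrite addr_ge0 // mulr_ge0.
have t0 : 0 <= b ^+ 2 * (b ^+ 2 - 3) by rewrite mulr_ge0 ?exprn_ge0.
apply/eqP; rewrite -oppr_eq0 eq_le oppr_le0 y1_ge0 /=.
(* The four inequalities, in order, receive the nonnegative multipliers [b ^+ 2 - 1],
   [b * (b ^+ 2 - 1)], [b ^+ 2] and [b]. *)
have -> : - y1 = b ^+ 2 * (b ^+ 2 - 3) * y1 +
    ((b ^+ 2 - 1) * (b * (y0 + y2 - b * y1) + (y1 - b * y0))
     + b * (b * (y1 + y3 - b * y2) + (y2 - b * y3))) by ring.
by rewrite !addr_ge0 ?mulr_ge0.
Qed.

(** * Vanishing of eigenvectors on good components *)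

Section Backward.
Variables (n : nat) (arc : rel 'I_n).
Notation H := (herm_adj arc).
Notation E := (underlying arc).

Variables (a : algC) (v : 'rV[algC]_n).
Hypothesis eig : v *m H = a *: v.
Hypothesis a3 : 3 <= `|a| ^+ 2.

Section Component.
Variables (C : {set 'I_n}) (m : nat) (G : rel 'I_m) (f : 'I_m -> 'I_n).
Hypothesis compC : weak_component arc C.
Hypothesis inj_f : injective f.
Hypothesis im_f : f @: [set: 'I_m] = C.
Hypothesis fG : forall i j, E (f i) (f j) = G i j.

(** No edge leaves a component, so the eigenvector equation restricts to it. *)
Lemma eigen_component i :
  a * v 0 (f i) = \sum_(j | G i j) v 0 (f j) * H (f j) (f i).
Proof.
have -> : a * v 0 (f i) = (v *m H) 0 (f i) by rewrite eig mxE.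
have inC j : f j \in C by rewrite -im_f imset_f.
rewrite mxE (bigID (mem C)) /= [X in _ + X]big1 ?addr0 => [|k kC].
  rewrite -im_f big_imset /=; last by move=> ? ? _ _ /inj_f.
  rewrite (bigID (G i)) /= [X in _ + X]big1 ?addr0 => [|j /andP[_ ij]].
    by apply: eq_bigl => j; rewrite inE.
  by rewrite herm_adj0 ?mulr0 // underlying_sym fG.
rewrite herm_adj0 ?mulr0 //; apply: contra kC; rewrite underlying_sym.
exact: component_closed.
Qed.

(** Passing to moduli removes the phases, so that on paths only the underlying graph matters. *)
Lemma eigen_component_le i :
  `|a| * `|v 0 (f i)| <= \sum_(j | G i j) `|v 0 (f j)|.
Proof.
rewrite -normrM eigen_component; apply: le_trans (ler_norm_sum _ _ _) _.
apply: ler_sum => j ij.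
by rewrite normrM norm_herm_adj underlying_sym fG ij mulr1.
Qed.

End Component.

Lemma path_component_eq0 (C : {set 'I_n}) k x :
    weak_component arc C -> (k <= 3)%N -> iso_on E C (@path_graph k) ->
  x \in C -> v 0 x = 0.
Proof.
move=> compC k3 [f [inj_f [im_f fG]]].
have le_f := eigen_component_le compC inj_f im_f fG.
pose Y (i : nat) : algC := `|v 0 (f (inord i))|.
have b0 := normr_ge0 a.
have Y_ge0 i : 0 <= Y i by apply: normr_ge0.
have leY i : (i <= k)%N -> `|a| * Y i <=
    \sum_(j < k.+1) (if (i.+1 == j) || (j.+1 == i) then Y j else 0).
  move=> ik; apply: le_trans (le_f _) _; rewrite big_mkcond /=.
  by apply: ler_sum => j _; rewrite /path_graph inordK // /Y inord_val.
suff Yeq0 (i : nat) : (i <= k)%N -> Y i = 0.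
  rewrite -im_f => /imsetP[i _ ->]; apply/normr0_eq0.
  by rewrite -[RHS](Yeq0 i) -1?ltnS // /Y inord_val.
have growth := path_growth_eq0 a3 b0.
(* Shorter paths are padded with zeros; each vertex is moved to the second place of
   [path_growth_eq0], reading the path backwards where necessary. *)
case: k k3 f inj_f im_f fG le_f Y Y_ge0 leY => [|[|[|[|k]]]] // _ f _ _ _ _ Y Y_ge0 leY.
- case: i => // _; have := leY 0%N isT; rewrite !big_ord_recl !big_ord0 /= !(addr0, add0r) => L0.
  by apply: (growth 0 _ 0 0); rewrite ?mulr0 ?(addr0, add0r).
- have := leY 0%N isT; have := leY 1%N isT.
  rewrite !big_ord_recl !big_ord0 /= /bump /= !(addr0, add0r) => L1 L0.
  case: i => [|[|//]] _.
    by apply: (growth 0 _ (Y 1%N) 0); rewrite ?mulr0 ?(addr0, add0r).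
  by apply: (growth 0 _ (Y 0%N) 0); rewrite ?mulr0 ?(addr0, add0r).
- have := leY 0%N isT; have := leY 1%N isT; have := leY 2%N isT.
  rewrite !big_ord_recl !big_ord0 /= /bump /= !(addr0, add0r) => L2 L1 L0.
  case: i => [|[|[|//]]] _.
  + by apply: (growth 0 _ (Y 1%N) (Y 2%N)); rewrite ?mulr0 ?(addr0, add0r).
  + by apply: (growth (Y 0%N) _ (Y 2%N) 0); rewrite ?mulr0 ?(addr0, add0r).
  + by apply: (growth 0 _ (Y 1%N) (Y 0%N)); rewrite ?mulr0 ?(addr0, add0r) // addrC.
have := leY 0%N isT; have := leY 1%N isT; have := leY 2%N isT; have := leY 3%N isT.
rewrite !big_ord_recl !big_ord0 /= /bump /= !(addr0, add0r) => L3 L2 L1 L0.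
(* With four vertices only the inner ones fit the second place; the ends follow from their vanishing
   neighbours. *)
have Y1 : Y 1%N = 0 by apply: (growth (Y 0%N) _ (Y 2%N) (Y 3%N)).
have Y2 : Y 2%N = 0 by apply: (growth (Y 3%N) _ (Y 1%N) (Y 0%N)); rewrite // addrC.
case: i => [|[|[|[|//]]]] _ //.
  by apply: (growth 0 _ 0 0); rewrite ?mulr0 ?addr0 // -Y1.
by apply: (growth 0 _ 0 0); rewrite ?mulr0 ?addr0 // -Y2.
Qed.

Lemma square_of_iso (C : {set 'I_n}) (f : 'I_4 -> 'I_n) (u := fun k => f (inord k)) :
    injective f -> f @: [set: 'I_4] = C ->
    (forall i j, E (f i) (f j) = cycle4 i j) ->
  square arc (u 0) (u 1) (u 2) (u 3) /\ C =i [:: u 0; u 1; u 2; u 3].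
Proof.
move=> inj_f im_f fG.
have Eu (i j : nat) : (i < 4)%N -> (j < 4)%N ->
    E (u i) (u j) = ((i.+1 %% 4 == j) || (j.+1 %% 4 == i))%N.
  by move=> i4 j4; rewrite fG /cycle4 !inordK.
split; last first.
  move=> y; rewrite -im_f; apply/imsetP/idP => [[i _ ->]|].
    by rewrite -[i]inord_val !inE; case: i => -[|[|[|[|i]]]] //= _; rewrite eqxx ?orbT.
  by rewrite !inE => /or4P[]/eqP->; eexists; rewrite // inE.
rewrite /square !Eu // !andbT.
rewrite -[[:: _; _; _; _]]/(map u (iota 0 4)) map_inj_in_uniq ?iota_uniq //.
move=> i j; rewrite !mem_iota /= => i4 j4 /inj_f/(congr1 (fun i : 'I_4 => i : nat)).
by rewrite !inordK.
Qed.

(* [a^2 v_u = 2 v_u] at both ends of a diagonal; if [v] vanishes there, then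
   [a v = 0] at the other two vertices. *)
Lemma square_component_eq0 (C : {set 'I_n}) (f : 'I_4 -> 'I_n) x
    (u := fun k => f (inord k)) :
    weak_component arc C -> injective f -> f @: [set: 'I_4] = C ->
    (forall i j, E (f i) (f j) = cycle4 i j) ->
    cancels arc (u 0) (u 1) (u 2) (u 3) ->
  x \in C -> v 0 x = 0.
Proof.
move=> compC inj_f im_f fG can xC.
have [sq Cs] := square_of_iso inj_f im_f fG.
have eq k : (k < 4)%N -> a * v 0 (u k) =
    \sum_(j < 4) (if ((k.+1 %% 4 == j) || (j.+1 %% 4 == k))%N
                  then v 0 (u j) * H (u j) (u k) else 0).
  move=> k4; rewrite (eigen_component compC inj_f im_f fG) big_mkcond.
  by apply: eq_bigr => j _; rewrite /cycle4 inordK // /u inord_val.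
have := eq 0 isT; have := eq 1 isT; have := eq 2 isT; have := eq 3 isT.
rewrite !big_ord_recl !big_ord0 /= /bump /= !(addr0, add0r) => eq3 eq2 eq1 eq0.
have s : H (u 0) (u 1) * H (u 1) (u 2) + H (u 0) (u 3) * H (u 3) (u 2) = 0.
  case/and5P: sq => _ e01 e12 e23 /andP[e30 _].
  rewrite !herm_adjE // 1?underlying_sym // -!exprD.
  by apply/eqP; rewrite expi_add_eq0.
(* The conjugate of [s], for the walks in the opposite direction. *)
have sC : H (u 2) (u 1) * H (u 1) (u 0) + H (u 2) (u 3) * H (u 3) (u 0) = 0.
  rewrite -[RHS]conjC0 -s rmorphD !rmorphM /= !herm_adj_conj.
  by rewrite [X in X + _]mulrC [X in _ + X]mulrC.
case/and5P: sq => _ e01 e12 e23 /andP[e30 _].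
have e10 : E (u 1) (u 0) by rewrite underlying_sym.
have e21 : E (u 2) (u 1) by rewrite underlying_sym.
have a2 : a ^+ 2 - 2 != 0.
  rewrite subr_eq0; apply: contraTneq a3 => a2.
  by rewrite -normrX a2 normr_nat ler_nat.
have a0 : a != 0 by apply: contraTneq a3 => ->; rewrite normr0 expr0n ler_nat.
(* The equation is applied twice: the two closed walks at [u 0] have weight 1 each, and the two
   walks from [u 2] cancel by [sC]. *)
have x0 : v 0 (u 0) = 0.
  apply/(mulfI a2); rewrite mulr0 mulrBl expr2 -mulrA eq0.
  rewrite mulrDr !mulrA eq1 eq3.
  transitivity (v 0 (u 0) * (H (u 0) (u 1) * H (u 1) (u 0) + H (u 3) (u 0) * H (u 0) (u 3) - 2)
    + v 0 (u 2) * (H (u 2) (u 1) * H (u 1) (u 0) + H (u 2) (u 3) * H (u 3) (u 0))).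
    by ring.
  by rewrite sC !herm_adj_mulC // -[1 + 1]/(2%:R) subrr !mulr0 addr0.
have x2 : v 0 (u 2) = 0.
  apply/(mulfI a2); rewrite mulr0 mulrBl expr2 -mulrA eq2.
  rewrite mulrDr !mulrA eq1 eq3.
  transitivity (v 0 (u 2) * (H (u 2) (u 1) * H (u 1) (u 2) + H (u 2) (u 3) * H (u 3) (u 2) - 2)
    + v 0 (u 0) * (H (u 0) (u 1) * H (u 1) (u 2) + H (u 0) (u 3) * H (u 3) (u 2))).
    by ring.
  by rewrite s !herm_adj_mulC // -[1 + 1]/(2%:R) subrr !mulr0 addr0.
have x1 : v 0 (u 1) = 0 by apply/(mulfI a0); rewrite eq1 x0 x2 !mul0r !mulr0 addr0.
have x3 : v 0 (u 3) = 0 by apply/(mulfI a0); rewrite eq3 x0 x2 !mul0r !mulr0 addr0.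
by move: xC; rewrite Cs !inE => /or4P[]/eqP->.
Qed.

Lemma good_component_eq0 (C : {set 'I_n}) x :
  weak_component arc C -> good_component arc C -> x \in C -> v 0 x = 0.
Proof.
move=> compC [[k [k3 iso]]|[[f [inj_f [im_f fG]]] good]].
  exact: path_component_eq0 compC k3 iso.
case: good => [[g [inj_g [im_g gG]]]|[sC dig]].
  (* Symmetrizing [ctilde4] gives [cycle4], so [g] is also an isomorphism of underlying graphs, and
     in its labelling the arcs are known. *)
  apply: (square_component_eq0 compC inj_g im_g).
    by move=> [[|[|[|[|i]]]] // Hi] [[|[|[|[|j]]]] // Hj]; rewrite underlyingE !gG.
  by apply: ctilde4_arcs_cancels; rewrite /ctilde4_arcs !gG /ctilde4 !inordK.
apply: (square_component_eq0 compC inj_f im_f fG).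
have [sq Cs] := square_of_iso inj_f im_f fG.
by apply: (strong_cancels sq Cs sC); rewrite -(num_digons_square sq Cs).
Qed.

End Backward.

Theorem theorem9p3 (n : nat) (arc : rel 'I_n) (irr : forall v, ~~ arc v v) :
  (forall a : algC, eigenvalue (herm_adj arc) a -> - sqrtC 3 < a < sqrtC 3)
  <-> (forall C : {set 'I_n}, weak_component arc C -> good_component arc C).
Proof.
have s3 : 0 <= sqrtC 3 :> algC by rewrite sqrtC_ge0.
have lt_sqr (a : algC) : (`|a| ^+ 2 < 3) = (`|a| < sqrtC 3).
  by rewrite -{1}[3]sqrtCK ltr_pXn2r // nnegrE.
split=> [eig C compC|good a eig].
  apply: (good_of_contraction irr) compC.
  apply: sqnorm_normal_lt (herm_adj_normal arc) _ => a eig_a.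
  (* The order on [algC] is partial, so passing from the two-sided bound to the modulus needs [a] to
     be real. *)
  by rewrite lt_sqr real_ltr_norml ?eig // (eigenvalue_herm_adj_real eig_a).
have aR := eigenvalue_herm_adj_real eig.
rewrite -real_ltr_norml // -lt_sqr real_ltNge ?realn ?realX ?normr_real //.
(* An eigenvector for such an [a] vanishes at each [x], by looking at the component of [x], and so
   is zero. *)
apply/negP => a3; case/eigenvalueP: eig => v va /negP[]; apply/eqP/rowP => x.
rewrite mxE; pose C := [set y | connect (underlying arc) x y].
have compC : weak_component arc C by exists x.
apply: (good_component_eq0 va a3 compC (good C compC)).
by rewrite inE connect0.
Qed.
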